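(* (Maximal Selection Principle for Product-TM System) Let $n\ge1$, let $f\in H^2(\mathbf T^2)$, and let $a_1,\dots,a_{n-1}$ and $b_1,\dots,b_{n-1}$ in $\mathbf D$ be previously fixed. Then there exist $a_n,b_n\in\mathbf D$ such that the associated quantity $$\|D_n(f)\|^2=\sum_{\max\{k,l\}=n}|\langle f,B^{\mathbf a}_k\otimes B^{\mathbf b}_l\rangle|^2$$ attains its maximal value among all possible selections of $a_n,b_n$ inside the unit disc $\mathbf D$.
   Context: $\mathbf D$ is the open unit disc and $\mathbf T=\partial\mathbf D$. $L^2(\mathbf T^2)$ has inner product $\langle f,g\rangle=\frac1{4\pi^2}\int_{-\pi}^{\pi}\int_{-\pi}^{\pi}f(e^{it},e^{is})\overline{g(e^{it},e^{is})}\,dt\,ds$, and $H^2(\mathbf T^2)$ is the closed subspace of functions of the form $\sum_{k,l\ge0}c_{kl}e^{i(kt+ls)}$. For $\mathbf a=\{a_1,a_2,\dots\}$ in $\mathbf D$ (repetitions allowed), the Takenaka-Malmquist functions are $B^{\mathbf a}_k(z)=\frac{\sqrt{1-|a_k|^2}}{1-\overline{a}_kz}\prod_{l=1}^{k-1}\frac{z-a_l}{1-\overline{a}_lz}$; $B^{\mathbf b}_l$ is defined similarly from $\mathbf b=\{b_1,b_2,\dots\}$, and $(B^{\mathbf a}_k\otimes B^{\mathbf b}_l)(z,w)=B^{\mathbf a}_k(z)B^{\mathbf b}_l(w)$. Set $S_n(f)=\sum_{1\le k,l\le n}\langle f,B^{\mathbf a}_k\otimes B^{\mathbf b}_l\rangle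 B^{\mathbf a}_k\otimes B^{\mathbf b}_l$, $S_0(f)=0$, and $D_n(f)=S_n(f)-S_{n-1}(f)$. *)

(* Defs.v *)
From HB Require Import structures.
From mathcomp Require Import all_boot all_order all_algebra.
From mathcomp Require Import complex.
From mathcomp Require Import all_classical all_reals all_analysis.

Set Implicit Arguments.
Unset Strict Implicit.
Unset Printing Implicit Defensive.

Import Order.TTheory GRing.Theory Num.Theory.
Import numFieldNormedType.Exports.

Local Open Scope classical_set_scope.
Local Open Scope ring_scope.

(* Real-valued modulus; the library's [`|z|] takes its values in [R[i]]. *)
Definition cmod (R : realType) (z : R[i]) : R := Normc.normc z.

Definition expi (R : realType) (t : R) : R[i] := (cos t +i* sin t)%C.

(* A function on the torus is represented by a function on [C * C]; only its
   values at the points [torus (t, s)] are ever used. *)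
Definition torus (R : realType) (x : R * R) : R[i] * R[i] :=
  (expi x.1, expi x.2).

Definition square (R : realType) : set (R * R) :=
  `[(- pi : R), pi] `*` `[(- pi : R), pi].

Definition leb2 (R : realType) : set (R * R) -> \bar R :=
  (@lebesgue_measure R \x @lebesgue_measure R)%E.

(* The mean over the torus, i.e. the integral against [dt ds / (4 pi ^ 2)]. *)
Definition torus_mean (R : realType) (h : R[i] * R[i] -> R[i]) : R[i] :=
  let I (g : R * R -> R) : R :=
    (4 * pi ^+ 2)^-1 * Rintegral (@leb2 R) (@square R) g in
  (I (fun x => complex.Re (h (torus x)))
    +i* I (fun x => complex.Im (h (torus x))))%C.

Definition inner (R : realType) (f g : R[i] * R[i] -> R[i]) : R[i] :=
  torus_mean (fun p => f p * (g p)^*%C).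

Definition l2norm (R : realType) (f : R[i] * R[i] -> R[i]) : R :=
  Num.sqrt (complex.Re (inner f f)).

Definition L2 (R : realType) (f : R[i] * R[i] -> R[i]) : Prop :=
  [/\ measurable_fun (@square R) (fun x => complex.Re (f (torus x))),
      measurable_fun (@square R) (fun x => complex.Im (f (torus x))) &
      integrable (@leb2 R) (@square R)
        (fun x => (cmod (f (torus x)) ^+ 2)%:E)].

(* [f] is the L^2 limit of the square partial sums of a double power series;
   on the torus [p.1 ^+ k * p.2 ^+ l] is [exp (i (k t + l s))]. *)
Definition H2 (R : realType) (f : R[i] * R[i] -> R[i]) : Prop :=
  L2 f /\
  exists c : nat -> nat -> R[i],
    (fun N : nat => l2norm (fun p =>
       f p - \sum_(k < N) \sum_(l < N) c k l * p.1 ^+ k * p.2 ^+ l))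
      @ \oo --> (0 : R).

(* Takenaka-Malmquist functions; the parameters are [a 1, a 2, ...] and the
   value [a 0] is not used when [1 <= k]. *)
Definition TM (R : realType) (a : nat -> R[i]) (k : nat) (z : R[i]) : R[i] :=
  (Num.sqrt (1 - cmod (a k) ^+ 2))%:C%C / (1 - (a k)^*%C * z)
  * \prod_(1 <= l < k) ((z - a l) / (1 - (a l)^*%C * z)).

Definition TM2 (R : realType) (a b : nat -> R[i]) (k l : nat)
    (p : R[i] * R[i]) : R[i] :=
  TM a k p.1 * TM b l p.2.

Definition Sn (R : realType) (a b : nat -> R[i]) (n : nat)
    (f : R[i] * R[i] -> R[i]) (p : R[i] * R[i]) : R[i] :=
  \sum_(1 <= k < n.+1) \sum_(1 <= l < n.+1)
    inner f (TM2 a b k l) * TM2 a b k l p.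

Definition Dn (R : realType) (a b : nat -> R[i]) (n : nat)
    (f : R[i] * R[i] -> R[i]) (p : R[i] * R[i]) : R[i] :=
  Sn a b n f p - Sn a b n.-1 f p.

(* Main.v *)
Require Import Defs.
From HB Require Import structures.
From mathcomp Require Import all_boot all_order all_algebra.
From mathcomp Require Import complex.
From mathcomp Require Import all_classical all_reals all_analysis.
From mathcomp Require Import measurable_realfun.
From mathcomp Require Import ring lra.

Import Order.TTheory GRing.Theory Num.Theory.
Import numFieldNormedType.Exports.

(** Two points carry the proof.

    The energy formula holds because the products B_k(z) B_l(w) are
    orthonormal, so that D_n(f), which is the sum of <f, e> e over the
    elements e with max(k, l) = n, has the sum of the |<f, e>|^2 as its
    squared norm ([sqr_l2norm_Dn]).  Orthonormality reduces to one variable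
    by Fubini ([inner_tensor]).  There, on the circle, B_l conj(B_k) for
    k < l is z times a product of Blaschke factors and factors 1/(1 - conj(a) z),
    and such functions have mean zero; |B_k|^2 is a Poisson kernel and has
    mean one.  The mean-zero property is proved without complex analysis: the
    class [hardy] of circle functions u such that z^(m+1) u has mean zero for
    all m is stable under multiplication by z and under division by
    1 - conj(a) z ([hardy_div]).

    For the existence of a maximum, B_n with last parameter x is a fixed
    Blaschke product times sqrt(1 - |x|^2) / (1 - conj(x) z), and this factor
    is identically zero for |x| >= 1 since the square root of a nonpositive
    number is 0.  The energy thus makes sense for all complex x and y, and it
    is continuous everywhere.  Indeed the inner products u_j = <z^j, B_n>
    satisfy the recursion u_(j+1) = x u_j + sqrt(1 - |x|^2) c_(j+1), where c_j
    is the inner product of z^j with the Blaschke product ([coeff_szegoM]), so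
    they depend continuously on x.  This settles the case where f is a
    polynomial.  A general f in H^2 is an L^2 limit of polynomials, and
    Bessel's inequality makes the convergence of the inner products uniform in
    x and y ([ccontinuous_inner_TM2]).  Continuity across the unit circle
    contains the usual boundary estimate, that the terms that involve x tend
    to 0 as |x| tends to 1.

    A continuous function attains its maximum on a compact cube that contains
    the closed bidisc.  If the maximum point has a coordinate outside the open
    disc, that coordinate is replaced by 0: the terms that involve it were
    zero and the others do not depend on it, so the energy does not decrease
    ([energy_retract]). *)

Set Implicit Arguments.
Unset Strict Implicit.
Unset Printing Implicit Defensive.

Local Open Scope ring_scope.

(** * Complex numbers through real and imaginary parts *)

Section ComplexArith.
Context {R : realType}.
Implicit Types z w : R[i].

Lemma Re_addc z w : complex.Re (z + w) = complex.Re z + complex.Re w.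
Proof. by case: z w => [a b] [c d]. Qed.
Lemma Im_addc z w : complex.Im (z + w) = complex.Im z + complex.Im w.
Proof. by case: z w => [a b] [c d]. Qed.
Lemma Re_mulc z w : complex.Re (z * w) = complex.Re z * complex.Re w - complex.Im z * complex.Im w.
Proof. by case: z w => [a b] [c d]. Qed.
Lemma Im_mulc z w : complex.Im (z * w) = complex.Re z * complex.Im w + complex.Im z * complex.Re w.
Proof. by case: z w => [a b] [c d]. Qed.
Lemma Re_conjc z : complex.Re z^*%C = complex.Re z.
Proof. by case: z. Qed.
Lemma Im_conjc z : complex.Im z^*%C = - complex.Im z.
Proof. by case: z. Qed.
Lemma conjD z w : (z + w)^*%C = z^*%C + w^*%C.
Proof. exact: rmorphD. Qed.
Lemma conjM z w : (z * w)^*%C = z^*%C * w^*%C.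
Proof. exact: rmorphM. Qed.
Lemma complex_ext z w : complex.Re z = complex.Re w -> complex.Im z = complex.Im w -> z = w.
Proof. by case: z w => [a b] [c d] /= -> ->. Qed.

Lemma sqr_cmod z : cmod z ^+ 2 = complex.Re z ^+ 2 + complex.Im z ^+ 2.
Proof. by case: z => a b; rewrite /cmod /= sqr_sqrtr // addr_ge0 ?sqr_ge0. Qed.

Lemma cmod_ge0 z : 0 <= cmod z.
Proof. by case: z => a b; rewrite /cmod /= sqrtr_ge0. Qed.

Lemma mulcJ z : z * z^*%C = (cmod z ^+ 2)%:C%C.
Proof.
apply: complex_ext; rewrite ?Re_mulc ?Im_mulc Re_conjc Im_conjc /= ?sqr_cmod; ring.
Qed.

Lemma cmodM z w : cmod (z * w) = cmod z * cmod w.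
Proof. exact: Normc.normcM. Qed.

Lemma cmodJ z : cmod z^*%C = cmod z.
Proof. by case: z => a b; rewrite /cmod /= sqrrN. Qed.

Lemma cmod0 : cmod (0 : R[i]) = 0.
Proof. exact: Normc.normc0. Qed.

Lemma cmod1 : cmod (1 : R[i]) = 1.
Proof. exact: Normc.normc1. Qed.

Lemma cmodX z k : cmod (z ^+ k) = cmod z ^+ k.
Proof. by elim: k => [|k IH]; rewrite ?expr0 ?cmod1 // !exprS cmodM IH. Qed.

Lemma norm_Re_le_cmod z : `|complex.Re z| <= cmod z.
Proof.
rewrite -(ler_pXn2r (n := 2)) ?nnegrE ?cmod_ge0 // sqr_cmod.
by rewrite real_normK ?num_real // lerDl sqr_ge0.
Qed.

Lemma norm_Im_le_cmod z : `|complex.Im z| <= cmod z.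
Proof.
rewrite -(ler_pXn2r (n := 2)) ?nnegrE ?cmod_ge0 // sqr_cmod.
by rewrite real_normK ?num_real // lerDr sqr_ge0.
Qed.

Lemma sqr_cmodD_le z w : cmod (z + w) ^+ 2 <= 2 * cmod z ^+ 2 + 2 * cmod w ^+ 2.
Proof.
rewrite !sqr_cmod Re_addc Im_addc -subr_ge0.
rewrite [leRHS](_ : _ = (complex.Re z - complex.Re w) ^+ 2
                     + (complex.Im z - complex.Im w) ^+ 2); last ring.
by rewrite addr_ge0 ?sqr_ge0.
Qed.

Lemma cmod_mul_le z w : cmod (z * w) <= cmod z ^+ 2 + cmod w ^+ 2.
Proof.
rewrite cmodM; have := cmod_ge0 z; have := cmod_ge0 w.
by move: (cmod z) (cmod w) => r s; nra.
Qed.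

Lemma conj_eq0 z : (z^*%C == 0) = (z == 0).
Proof. by case: z => a b; rewrite !eq_complex /= oppr_eq0. Qed.

End ComplexArith.

(** * Continuity of complex-valued functions *)

(** Continuity is expressed by real and imaginary parts, so that integrals and
    extrema of real functions apply directly. *)
Definition ccontinuous (R : realType) (T : topologicalType) (u : T -> R[i]) : Prop :=
  continuous (fun x => complex.Re (u x)) /\ continuous (fun x => complex.Im (u x)).

Section CContinuous.
Context {R : realType} {T : topologicalType}.
Implicit Types u v : T -> R[i].

Lemma eq_ccontinuous u v : u =1 v -> ccontinuous u -> ccontinuous v.
Proof. by move=> /funext ->. Qed.

Lemma ccontinuous_cst (c : R[i]) : ccontinuous (fun _ : T => c).
Proof. by split=> x; apply: cvg_cst. Qed.

Lemma ccontinuous_real (f : T -> R) : continuous f -> ccontinuous (fun x => (f x)%:C%C).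
Proof. by split=> // x; apply: cvg_cst. Qed.

Lemma ccontinuousD u v : ccontinuous u -> ccontinuous v -> ccontinuous (fun x => u x + v x).
Proof.
move=> [ru iu] [rv iv]; split=> x.
  under eq_fun do rewrite Re_addc; exact: (continuousD (ru x) (rv x)).
under eq_fun do rewrite Im_addc; exact: (continuousD (iu x) (iv x)).
Qed.

Lemma ccontinuousM u v : ccontinuous u -> ccontinuous v -> ccontinuous (fun x => u x * v x).
Proof.
move=> [ru iu] [rv iv]; split=> x.
  under eq_fun do rewrite Re_mulc.
  exact: (continuousB (continuousM (ru x) (rv x)) (continuousM (iu x) (iv x))).
under eq_fun do rewrite Im_mulc.
exact: (continuousD (continuousM (ru x) (iv x)) (continuousM (iu x) (rv x))).
Qed.

Lemma ccontinuousJ u : ccontinuous u -> ccontinuous (fun x => (u x)^*%C).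
Proof.
move=> [ru iu]; split=> x; first by under eq_fun do rewrite Re_conjc; exact: ru.
under eq_fun do rewrite Im_conjc; exact: (continuousN (iu x)).
Qed.

Lemma ccontinuousB u v : ccontinuous u -> ccontinuous v -> ccontinuous (fun x => u x - v x).
Proof.
move=> cu cv; apply: (eq_ccontinuous (u := fun x => u x + (-1) * v x)).
  by move=> x; rewrite mulN1r.
exact: ccontinuousD cu (ccontinuousM (ccontinuous_cst _) cv).
Qed.

Lemma continuous_sqr_cmod u : ccontinuous u -> continuous (fun x => cmod (u x) ^+ 2).
Proof.
move=> [ru iu] x; under eq_fun do rewrite sqr_cmod !expr2.
exact: (continuousD (continuousM (ru x) (ru x)) (continuousM (iu x) (iu x))).
Qed.

Lemma continuous_cmod u : ccontinuous u -> continuous (fun x => cmod (u x)).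
Proof.
move=> cu x.
rewrite (_ : (fun x => _) = Num.sqrt \o (fun x => cmod (u x) ^+ 2)); last first.
  by apply/funext => y /=; rewrite sqrtr_sqr ger0_norm ?cmod_ge0.
apply: continuous_comp; first exact: continuous_sqr_cmod.
exact: sqrt_continuous.
Qed.

Lemma ccontinuousV u : (forall x, u x != 0) -> ccontinuous u -> ccontinuous (fun x => (u x)^-1).
Proof.
move=> u0 cu.
have nz x : cmod (u x) ^+ 2 != 0.
  by rewrite sqrf_eq0; apply: contra (u0 x) => /eqP/Normc.eq0_normc ->.
apply: (eq_ccontinuous (u := fun x => (u x)^*%C * ((cmod (u x) ^+ 2)^-1)%:C%C)).
  move=> x; apply: (mulfI (u0 x)); rewrite mulfV // mulrA mulcJ -rmorphM /=.
  by rewrite mulfV.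
apply: ccontinuousM; first exact: ccontinuousJ.
by apply: ccontinuous_real => x; apply: cvgV => //; exact: continuous_sqr_cmod.
Qed.

Lemma ccontinuous_sum (I : Type) (r : seq I) (P : pred I) (F : I -> T -> R[i]) :
  (forall i, ccontinuous (F i)) -> ccontinuous (fun x => \sum_(i <- r | P i) F i x).
Proof.
move=> cF; elim: r => [|i r IH].
  by apply: eq_ccontinuous (ccontinuous_cst 0) => x; rewrite big_nil.
case Pi: (P i).
  by apply: eq_ccontinuous (ccontinuousD (cF i) IH) => x; rewrite big_cons Pi.
by apply: eq_ccontinuous IH => x; rewrite big_cons Pi.
Qed.

Lemma ccontinuousX u k : ccontinuous u -> ccontinuous (fun x => u x ^+ k).
Proof.
move=> cu; elim: k => [|k IH]; first exact: ccontinuous_cst.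
by apply: eq_ccontinuous (ccontinuousM cu IH) => x; rewrite exprS.
Qed.

Lemma ccontinuous_uniform_limit u :
  (forall e, 0 < e -> exists2 v, ccontinuous v & forall x, cmod (u x - v x) <= e) ->
  ccontinuous u.
Proof.
move=> H.
have key (p : R[i] -> R) : (forall z w, p (z - w) = p z - p w) ->
    (forall z, `|p z| <= cmod z) ->
    (forall v, ccontinuous v -> continuous (fun x => p (v x))) ->
    continuous (fun x => p (u x)).
  move=> pB ple pc x; apply/cvgrPdist_le => /= e e0.
  have e3 : 0 < e / 3 by rewrite divr_gt0.
  have [v cv uv] := H _ e3.
  have /cvgrPdist_le/(_ _ e3) := pc v cv x.
  apply: filterS => y /= vxy.
  have h t : `|p (u t) - p (v t)| <= e / 3 by rewrite -pB (le_trans (ple _)).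
  have := h x; have := h y; move: vxy; rewrite !ler_norml; lra.
split; apply: key => [z w|z|v []//].
- by rewrite Re_addc; case: w.
- exact: norm_Re_le_cmod.
- by rewrite Im_addc; case: w.
- exact: norm_Im_le_cmod.
Qed.

End CContinuous.

(** * Integrals of complex-valued functions *)

Section CInt.
Context d (T : measurableType d) (R : realType).
Variables (mu : {measure set T -> \bar R}) (D : set T).
Hypothesis mD : measurable D.
Implicit Types h : T -> R[i].

Definition cint h : R[i] :=
  (Rintegral mu D (fun x => complex.Re (h x)) +i* Rintegral mu D (fun x => complex.Im (h x)))%C.

Definition cintegrable h : Prop :=
  mu.-integrable D (EFin \o (fun x => complex.Re (h x))) /\
  mu.-integrable D (EFin \o (fun x => complex.Im (h x))).

Lemma eq_cint h1 h2 : h1 =1 h2 -> cint h1 = cint h2.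
Proof. by move=> /funext ->. Qed.

Lemma rintegrableD (f g : T -> R) : mu.-integrable D (EFin \o f) -> mu.-integrable D (EFin \o g) ->
  mu.-integrable D (EFin \o (fun x => f x + g x)).
Proof. by move=> If Ig; apply: eq_integrable (integrableD mD If Ig). Qed.

Lemma rintegrableZ (r : R) (g : T -> R) : mu.-integrable D (EFin \o g) ->
  mu.-integrable D (EFin \o (fun x => r * g x)).
Proof. by move=> Ig; apply: eq_integrable (integrableZl mD r Ig). Qed.

Lemma cintD h1 h2 : cintegrable h1 -> cintegrable h2 ->
  cint (fun x => h1 x + h2 x) = cint h1 + cint h2.
Proof.
move=> [r1 i1] [r2 i2]; apply: complex_ext; rewrite ?Re_addc ?Im_addc /cint /=.
  by under eq_fun do rewrite Re_addc; rewrite RintegralD.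
by under eq_fun do rewrite Im_addc; rewrite RintegralD.
Qed.

Lemma cintZ c h : cintegrable h -> cint (fun x => c * h x) = c * cint h.
Proof.
move=> [r i]; apply: complex_ext; rewrite ?Re_mulc ?Im_mulc /cint /=.
  under eq_fun do rewrite Re_mulc -mulNr.
  by rewrite RintegralD ?RintegralZl ?mulNr //; apply: rintegrableZ.
under eq_fun do rewrite Im_mulc.
by rewrite RintegralD ?RintegralZl //; apply: rintegrableZ.
Qed.

Lemma cintJ h : cintegrable h -> cint (fun x => (h x)^*%C) = (cint h)^*%C.
Proof.
move=> [r i]; apply: complex_ext; rewrite ?Re_conjc ?Im_conjc /cint /=.
  by under eq_fun do rewrite Re_conjc.
by under eq_fun do rewrite Im_conjc -mulN1r; rewrite RintegralZl // mulN1r.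
Qed.

Lemma le_cintegrable (h : T -> R[i]) (g : T -> R) :
  measurable_fun D (fun x => complex.Re (h x)) ->
  measurable_fun D (fun x => complex.Im (h x)) ->
  mu.-integrable D (EFin \o g) -> (forall x, cmod (h x) <= g x) -> cintegrable h.
Proof.
move=> mr mi Ig hg; split; apply: (le_integrable mD _ _ Ig).
- exact/measurable_EFinP.
- move=> x _ /=; rewrite lee_fin (le_trans (norm_Re_le_cmod _)) // (le_trans (hg _)) //.
  exact: ler_norm.
- exact/measurable_EFinP.
- move=> x _ /=; rewrite lee_fin (le_trans (norm_Im_le_cmod _)) // (le_trans (hg _)) //.
  exact: ler_norm.
Qed.

(** The constant 2 comes from bounding the real and the imaginary part of the
    integral separately. *)
Lemma cint_bound h (g : T -> R) : cintegrable h -> mu.-integrable D (EFin \o g) ->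
  (forall x, cmod (h x) <= g x) -> cmod (cint h) ^+ 2 <= 2 * Rintegral mu D g ^+ 2.
Proof.
move=> [r i] Ig hg.
have key (f : T -> R) : mu.-integrable D (EFin \o f) -> (forall x, `|f x| <= g x) ->
    (Rintegral mu D f) ^+ 2 <= Rintegral mu D g ^+ 2.
  move=> If fg.
  have G0 : 0 <= Rintegral mu D g.
    by apply: Rintegral_ge0 => x _; apply: le_trans (fg x).
  rewrite -[X in X <= _]real_normK ?num_real // ler_pXn2r ?nnegrE //.
  apply: le_trans (le_normr_Rintegral mD If) _.
  by apply: le_Rintegral => //; apply: integrable_norm.
rewrite sqr_cmod /cint /= mulr_natl mulr2n; apply: lerD; apply: key => // x.
  exact: le_trans (norm_Re_le_cmod _) (hg _).
exact: le_trans (norm_Im_le_cmod _) (hg _).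
Qed.

End CInt.

(** * The mean over the circle and the Hardy class *)

Section CircleMean.
Context {R : realType}.
Implicit Types u v : R[i] -> R[i].
Local Notation leb := (@lebesgue_measure R).
Local Notation arc := (`[(- pi : R), pi]%classic : set R).

Lemma pi_neq0 : pi != 0 :> R.
Proof. by rewrite gt_eqF ?pi_gt0. Qed.

Lemma ltNpipi : - pi < pi :> R.
Proof. by rewrite gtrN ?pi_gt0. Qed.

Lemma measurable_arc : measurable arc.
Proof. exact: measurable_itv. Qed.

Lemma continuous_integrable_arc (f : R -> R) : continuous f -> leb.-integrable arc (EFin \o f).
Proof.
move=> cf; apply: continuous_compact_integrable; first exact: segment_compact.
exact: continuous_subspaceT.
Qed.

Lemma ccontinuous_cintegrable_arc (h : R -> R[i]) : ccontinuous h -> cintegrable leb arc h.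
Proof. by move=> [r i]; split; exact: continuous_integrable_arc. Qed.

Lemma ccontinuous_expi : ccontinuous (@expi R).
Proof. by split; [exact: continuous_cos|exact: continuous_sin]. Qed.

Lemma cmod_expi (t : R) : cmod (expi t) = 1.
Proof. by rewrite /cmod /= cos2Dsin2 sqrtr1. Qed.

Lemma expi_neq0 (t : R) : expi t != 0.
Proof. by apply/eqP => /(congr1 (@cmod R)); rewrite cmod_expi cmod0; apply/eqP/oner_neq0. Qed.

Lemma expiJ (t : R) : (expi t)^*%C = (expi t)^-1.
Proof.
apply: (mulfI (expi_neq0 t)); rewrite mulfV ?expi_neq0 // mulcJ cmod_expi expr1n.
by rewrite rmorph1.
Qed.

Lemma expiX (t : R) k : expi t ^+ k = expi (k%:R * t).
Proof.
elim: k => [|k IH]; first by rewrite expr0 mul0r /expi cos0 sin0.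
rewrite exprS IH -natr1 mulrDl mul1r /expi cosD sinD.
by apply: complex_ext; rewrite ?Re_mulc ?Im_mulc /=; ring.
Qed.

Definition circle_continuous u : Prop := ccontinuous (u \o @expi R).

Definition circle_mean u : R[i] := ((2 * pi)^-1)%:C%C * cint leb arc (u \o @expi R).

Lemma eq_circle_mean u v : (forall t, u (expi t) = v (expi t)) -> circle_mean u = circle_mean v.
Proof. by move=> uv; congr (_ * _); apply: eq_cint => t /=. Qed.

Lemma circle_meanD u v : circle_continuous u -> circle_continuous v ->
  circle_mean (fun z => u z + v z) = circle_mean u + circle_mean v.
Proof.
move=> cu cv; rewrite /circle_mean -mulrDr; congr (_ * _).
by apply: cintD; [exact: measurable_arc|exact: ccontinuous_cintegrable_arc..].
Qed.

Lemma circle_meanZ c u : circle_continuous u -> circle_mean (fun z => c * u z) = c * circle_mean u.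
Proof.
move=> cu; rewrite /circle_mean mulrCA; congr (_ * _).
by apply: cintZ; [exact: measurable_arc|exact: ccontinuous_cintegrable_arc].
Qed.

Lemma circle_meanJ u : circle_continuous u -> circle_mean (fun z => (u z)^*%C) = (circle_mean u)^*%C.
Proof.
move=> cu; rewrite /circle_mean conjM conjc_real; congr (_ * _).
by apply: cintJ; [exact: measurable_arc|exact: ccontinuous_cintegrable_arc].
Qed.

Lemma circle_mean_cst c : circle_mean (fun=> c) = c.
Proof.
rewrite /circle_mean /cint.
have I (r : R) : Rintegral leb arc (fun=> r) = 2 * pi * r.
  rewrite Rintegral_cst; last exact: measurable_arc.
  rewrite /= lebesgue_measure_itv /= lte_fin ltNpipi /= opprK.
  by rewrite mulrC; congr (_ * _); ring.
apply: complex_ext; rewrite ?Re_mulc ?Im_mulc /= !I mul0r ?subr0 ?addr0 mulrA mulVf ?mul1r //.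
all: by rewrite mulf_neq0 ?pi_neq0 ?pnatr_eq0.
Qed.

(** By the fundamental theorem of calculus, since the primitive takes the same
    value at both ends of the arc. *)
Lemma integral_deriv_periodic (f F : R -> R) : continuous f ->
  (forall t, is_derive t (1 : R) F (f t)) -> F pi = F (- pi) ->
  Rintegral leb arc f = 0.
Proof.
move=> cf dF FE.
have cF : continuous F.
  move=> t; apply: differentiable_continuous; apply/derivable1_diffP.
  by have [] := dF t.
rewrite /Rintegral (@continuous_FTC2 _ f F) ?ltNpipi //.
- by rewrite FE -EFinB subrr.
- exact: continuous_subspaceT.
- split.
  + by move=> t _; have [] := dF t.
  + exact: cvg_at_right_filter (cF _).
  + exact: cvg_at_left_filter (cF _).
- by move=> t _; rewrite derive1E; have [_ ->] := dF t.
Qed.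

Lemma circle_mean_pow k : circle_mean (fun z => z ^+ k.+1) = 0.
Proof.
have k0 : k.+1%:R != 0 :> R by rewrite pnatr_eq0.
have cm (t : R) : {for t, continuous (fun s : R => k.+1%:R * s)}.
  by apply: cvgMr; apply: cvg_id.
rewrite /circle_mean [cint _ _ _](_ : _ = cint leb arc (fun t => expi (k.+1%:R * t))); last first.
  by apply: eq_cint => t /=; rewrite expiX.
rewrite [cint _ _ _](_ : _ = 0) ?mulr0 //; apply: complex_ext; rewrite /cint /=.
  apply: (@integral_deriv_periodic _ (fun t => k.+1%:R^-1 * sin (k.+1%:R * t))).
  - by move=> t; apply: continuous_comp; [exact: cm|exact: continuous_cos].
  - move=> t; apply: is_derive_eq; rewrite /GRing.scale /=; by field.
  - rewrite mulrN sinN.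
    suff -> : sin (k.+1%:R * pi) = 0 :> R by rewrite oppr0.
    elim: (k.+1) => [|m IH]; first by rewrite mul0r sin0.
    by rewrite -natr1 mulrDl mul1r sinDpi IH oppr0.
apply: (@integral_deriv_periodic _ (fun t => - k.+1%:R^-1 * cos (k.+1%:R * t))).
- by move=> t; apply: continuous_comp; [exact: cm|exact: continuous_sin].
- move=> t; apply: is_derive_eq; rewrite /GRing.scale /=; by field.
- by rewrite mulrN cosN.
Qed.

Lemma circle_continuousM u v : circle_continuous u -> circle_continuous v ->
  circle_continuous (fun z => u z * v z).
Proof. by move=> cu cv; exact (ccontinuousM cu cv). Qed.

Lemma circle_continuousX k : circle_continuous (fun z => z ^+ k).
Proof. exact (ccontinuousX k ccontinuous_expi). Qed.

(** The bound depends on [u] only through a majorant [v] of its modulus; below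
    it is used for the family z^j v, which has the common majorant [v]. *)
Lemma circle_mean_bound u v : circle_continuous u -> circle_continuous v ->
  (forall t, cmod (u (expi t)) <= cmod (v (expi t))) ->
  cmod (circle_mean u) ^+ 2 <=
    cmod ((2 * pi)^-1)%:C%C ^+ 2 *
    (2 * Rintegral leb arc (fun t => cmod (v (expi t))) ^+ 2).
Proof.
move=> cu cv uv; rewrite /circle_mean cmodM exprMn ler_wpM2l ?sqr_ge0 //.
apply: cint_bound => //.
- exact: ccontinuous_cintegrable_arc.
- exact/continuous_integrable_arc/continuous_cmod.
Qed.

(** Membership in the Hardy space of the disc: the mean of z^(m+1) u is the
    Fourier coefficient of index -(m+1) of u. *)
Definition hardy u : Prop :=
  circle_continuous u /\ forall m, circle_mean (fun z => z ^+ m.+1 * u z) = 0.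

(** Only the values on the circle matter, so identities such as z conj(z) = 1
    may be used. *)
Lemma eq_hardy u v : (forall t, u (expi t) = v (expi t)) -> hardy u -> hardy v.
Proof.
move=> uv [cu mu]; split; first by apply: eq_ccontinuous cu => t /=.
by move=> m; rewrite -(mu m); apply: eq_circle_mean => t; rewrite uv.
Qed.

Lemma hardy_cst c : hardy (fun=> c).
Proof.
split=> [|m]; first exact: ccontinuous_cst.
rewrite (@eq_circle_mean _ (fun z => c * z ^+ m.+1)); last by move=> t; rewrite mulrC.
by rewrite circle_meanZ ?circle_mean_pow ?mulr0 //; exact: circle_continuousX.
Qed.

Lemma hardyD u v : hardy u -> hardy v -> hardy (fun z => u z + v z).
Proof.
move=> [cu mu] [cv mv]; split=> [|m]; first exact: ccontinuousD.
rewrite (@eq_circle_mean _ (fun z => z ^+ m.+1 * u z + z ^+ m.+1 * v z)); last first.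
  by move=> t; rewrite mulrDr.
rewrite circle_meanD ?mu ?mv ?addr0 //;
  by apply: circle_continuousM => //; exact: circle_continuousX.
Qed.

Lemma hardyZ c u : hardy u -> hardy (fun z => c * u z).
Proof.
move=> [cu mu]; split=> [|m]; first exact: ccontinuousM (ccontinuous_cst _) cu.
rewrite (@eq_circle_mean _ (fun z => c * (z ^+ m.+1 * u z))); last first.
  by move=> t; rewrite mulrCA.
by rewrite circle_meanZ ?mu ?mulr0 //; apply: circle_continuousM => //; exact: circle_continuousX.
Qed.

Lemma hardyMX u : hardy u -> hardy (fun z => z * u z).
Proof.
move=> [cu mu]; split=> [|m]; first exact: ccontinuousM ccontinuous_expi cu.
by rewrite -(mu m.+1); apply: eq_circle_mean => t; rewrite mulrA -exprSr.
Qed.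

Lemma mobius_denominator_neq0 (a z : R[i]) : cmod a < 1 -> cmod z = 1 -> 1 - a^*%C * z != 0.
Proof.
move=> a1 z1; apply/eqP => /eqP; rewrite subr_eq0 => /eqP/(congr1 (@cmod R)).
by rewrite cmod1 cmodM cmodJ z1 mulr1 => /eqP; rewrite gt_eqF.
Qed.

Lemma circle_continuous_invden a : cmod a < 1 ->
  circle_continuous (fun z => (1 - a^*%C * z)^-1).
Proof.
move=> a1; apply: ccontinuousV.
  by move=> t /=; rewrite mobius_denominator_neq0 ?cmod_expi.
apply: ccontinuousB; first exact: ccontinuous_cst.
exact: ccontinuousM (ccontinuous_cst _) ccontinuous_expi.
Qed.

Lemma eq0_geometric_bound (r K x : R) : 0 <= r -> r < 1 -> 0 <= x ->
  (forall j : nat, x <= r ^+ j * K) -> x = 0.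
Proof.
move=> r0 r1 x0 H; apply/eqP; rewrite eq_le x0 andbT.
have rK : ((fun j : nat => r ^+ j * K) @ \oo --> (0 * K : R))%classic.
  apply: cvgM; last exact: cvg_cst.
  by apply: cvg_expr; rewrite ger0_norm.
rewrite mul0r in rK.
by apply: cvgr_to_ge rK _; apply: nearW.
Qed.

(** Let M_m be the mean of z^(m+1) v with v = u / (1 - conj(a) z).
    Multiplying v by 1 - conj(a) z gives M_m - conj(a) M_(m+1) = 0, hence M_m
    = conj(a)^j M_(m+j) for all j.  The M_m are bounded and |a| < 1, so M_m =
    0. *)
Lemma hardy_div a u : cmod a < 1 -> hardy u -> hardy (fun z => u z / (1 - a^*%C * z)).
Proof.
move=> a1 [cu mu].
set v := fun z => _.
have cv : circle_continuous v by apply: ccontinuousM cu (circle_continuous_invden a1).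
split=> // m.
have cXv k : circle_continuous (fun z => z ^+ k * v z).
  by apply: circle_continuousM => //; exact: circle_continuousX.
have step k : circle_mean (fun z => z ^+ k.+1 * v z) = a^*%C * circle_mean (fun z => z ^+ k.+2 * v z).
  apply/eqP; rewrite -subr_eq0 -(mu k) -mulN1r mulrA -circle_meanZ // -circle_meanD //; last first.
    exact: ccontinuousM (ccontinuous_cst _) (cXv _).
  apply/eqP; apply: eq_circle_mean => t; rewrite /v.
  have := mobius_denominator_neq0 a1 (cmod_expi t).
  by move: (expi t) (u _) => z w nz; rewrite [z ^+ _.+2]exprS; field.
have iter j : circle_mean (fun z => z ^+ m.+1 * v z)
            = a^*%C ^+ j * circle_mean (fun z => z ^+ (m + j).+1 * v z).
  elim: j => [|j IH]; first by rewrite addn0 expr0 mul1r.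
  by rewrite IH step addnS mulrA -exprSr.
apply: Normc.eq0_normc; rewrite -/(cmod _).
apply/eqP; rewrite -sqrf_eq0; apply/eqP.
pose K := cmod ((2 * pi)^-1)%:C%C ^+ 2 *
  (2 * Rintegral leb arc (fun t => cmod (v (expi t))) ^+ 2).
apply: (@eq0_geometric_bound (cmod a ^+ 2) K).
- exact: sqr_ge0.
- by rewrite expr_lt1 ?cmod_ge0.
- exact: sqr_ge0.
move=> j; rewrite (iter j) cmodM cmodX cmodJ exprMn -!exprM mulnC ler_wpM2l ?exprn_ge0 ?cmod_ge0 //.
apply: circle_mean_bound => // t.
by rewrite cmodM cmodX cmod_expi expr1n mul1r.
Qed.

Lemma hardy_blaschke a u : cmod a < 1 -> hardy u ->
  hardy (fun z => (z - a) / (1 - a^*%C * z) * u z).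
Proof.
move=> a1 hu.
apply: eq_hardy (hardy_div a1 (hardyD (hardyMX hu) (hardyZ (- a) hu))) => t.
by ring.
Qed.

Lemma circle_mean_hardyMX u : hardy u -> circle_mean (fun z => z * u z) = 0.
Proof. by move=> [_ /(_ 0%N)]. Qed.

End CircleMean.

(** * Takenaka-Malmquist functions of one variable *)

Section TakenakaMalmquist.
Context {R : realType}.
Implicit Types (a : nat -> R[i]) (x z : R[i]).

Definition blaschke a k z : R[i] :=
  \prod_(1 <= l < k) ((z - a l) / (1 - (a l)^*%C * z)).

(** The normalized Szego kernel.  For |x| >= 1 it is identically zero, because
    the square root of a nonpositive number is 0; the maximization below
    relies on this. *)
Definition szego x z : R[i] := (Num.sqrt (1 - cmod x ^+ 2))%:C%C / (1 - x^*%C * z).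

Lemma TME a k z : TM a k z = szego (a k) z * blaschke a k z.
Proof. by []. Qed.

Lemma sqrt_defect0 x : 1 <= cmod x -> Num.sqrt (1 - cmod x ^+ 2) = 0.
Proof.
move=> x1; apply: ler0_sqrtr; rewrite subr_le0 -[X in X <= _](expr1n _ 2).
by rewrite ler_pXn2r // nnegrE ?cmod_ge0.
Qed.

Lemma sqr_defect x : cmod x < 1 ->
  (Num.sqrt (1 - cmod x ^+ 2))%:C%C * (Num.sqrt (1 - cmod x ^+ 2))%:C%C = 1 - x * x^*%C.
Proof.
move=> x1; rewrite mulcJ; apply: complex_ext; rewrite ?Re_mulc ?Im_mulc ?Re_addc ?Im_addc /=; last by ring.
rewrite mulr0 subr0 -expr2 sqr_sqrtr // subr_ge0 expr_le1 ?cmod_ge0 //.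
exact: ltW.
Qed.

Lemma szego_out x z : 1 <= cmod x -> szego x z = 0.
Proof. by move=> x1; rewrite /szego sqrt_defect0 // rmorph0 mul0r. Qed.

Lemma hardy_blaschke_prod a k : (forall l, (1 <= l < k)%N -> cmod (a l) < 1) ->
  hardy (blaschke a k).
Proof.
elim: k => [|k IH] ak.
  by apply: eq_hardy (hardy_cst 1) => t; rewrite /blaschke big_geq.
case: k IH ak => [|k] IH ak.
  by apply: eq_hardy (hardy_cst 1) => t; rewrite /blaschke big_geq.
apply: (@eq_hardy _ (fun z => (z - a k.+1) / (1 - (a k.+1)^*%C * z) * blaschke a k.+1 z)).
  by move=> t; rewrite /blaschke [RHS]big_nat_recr //= mulrC.
apply: hardy_blaschke; first by apply: ak; rewrite leqnn.
by apply: IH => l /andP[l1 lk]; apply: ak; rewrite l1 ltnW.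
Qed.

Lemma hardy_szegoM x (u : R[i] -> R[i]) : hardy u -> hardy (fun z => szego x z * u z).
Proof.
move=> hu; have [x1|x1] := ltP (cmod x) 1; last first.
  by apply: eq_hardy (hardy_cst 0) => t; rewrite szego_out // mul0r.
apply: eq_hardy (hardyZ (Num.sqrt (1 - cmod x ^+ 2))%:C%C (hardy_div x1 hu)) => t.
by rewrite /szego -!mulrA; congr (_ * _); rewrite mulrC.
Qed.

Lemma hardy_TM a k : (forall l, (1 <= l < k)%N -> cmod (a l) < 1) -> hardy (TM a k).
Proof. by move=> ak; apply: hardy_szegoM; apply: hardy_blaschke_prod. Qed.

Lemma conj_mobius_denominator x t : (1 - x^*%C * expi t)^*%C = 1 - x * (expi t)^-1.
Proof. by rewrite rmorphB rmorph1 /= conjM conjcK expiJ. Qed.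

(** On the circle, z - x = z conj(1 - conj(x) z). *)
Lemma mobius_circleE x t :
  (expi t - x) / (1 - x^*%C * expi t) =
  expi t * (1 - x^*%C * expi t)^*%C / (1 - x^*%C * expi t).
Proof. by rewrite conj_mobius_denominator mulrBr mulr1 mulrCA mulfV ?expi_neq0 // mulr1. Qed.

Lemma mul_conj_mobius x t : cmod x < 1 ->
  (expi t - x) / (1 - x^*%C * expi t) * ((expi t - x) / (1 - x^*%C * expi t))^*%C = 1.
Proof.
move=> x1; have d0 := mobius_denominator_neq0 x1 (cmod_expi t).
rewrite mobius_circleE !conjM conjc_inv conjcK expiJ; move: d0; set d := (1 - _) => d0.
have := expi_neq0 t; have : d^*%C != 0 by rewrite conj_eq0.
by move: (d^*%C) (expi t) => d' z d'0 z0; field; rewrite d0 d'0 z0.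
Qed.

Lemma mul_conj_blaschke a k t : (forall l, (1 <= l < k)%N -> cmod (a l) < 1) ->
  blaschke a k (expi t) * (blaschke a k (expi t))^*%C = 1.
Proof.
move=> ak; rewrite /blaschke rmorph_prod -big_split big_nat big1 //= => l lk.
by rewrite mul_conj_mobius // ak.
Qed.

(** On the circle |B_k|^2 is the Poisson kernel (1 - |x|^2) / |1 - conj(x)
    z|^2, which equals 1 + g + conj(g) with g = conj(x) z / (1 - conj(x) z),
    and g has mean zero because it is z times a function of the Hardy
    class. *)
Lemma circle_mean_TM_norm a k : (forall l, (1 <= l < k)%N -> cmod (a l) < 1) -> cmod (a k) < 1 ->
  circle_mean (fun z => TM a k z * (TM a k z)^*%C) = 1.
Proof.
move=> ak x1; set x := a k in x1 *.
pose g z := x^*%C * (z * (1 / (1 - x^*%C * z))).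
have hg : hardy g by apply/hardyZ/hardyMX/hardy_div => //; exact: hardy_cst.
have g0 : circle_mean g = 0.
  rewrite circle_meanZ; first by rewrite circle_mean_hardyMX ?mulr0 //; apply/hardy_div/hardy_cst.
  by have [] := hardyMX (hardy_div x1 (hardy_cst 1)).
rewrite (@eq_circle_mean _ _ (fun z => 1 + (g z + (g z)^*%C))); last first.
  move=> t; rewrite !TME conjM mulrACA mul_conj_blaschke // mulr1 -/x /szego /g.
  have d0 := mobius_denominator_neq0 x1 (cmod_expi t).
  rewrite !conjM conjcK !conjc_inv conjc_real mulrACA sqr_defect // conjc1 conj_mobius_denominator.
  have d'0 : 1 - x * (expi t)^-1 != 0 by rewrite -conj_mobius_denominator conj_eq0.
  rewrite expiJ [x * x^*%C](_ : _ = (x^*%C * expi t) * (x * (expi t)^-1)); last first.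
    by rewrite mulrACA mulfV ?expi_neq0 // mulr1 mulrC.
  rewrite !mul1r (mulrA (x^*%C)) (mulrA x).
  move: d0 d'0; move: (_ * expi t) (_ * (expi t)^-1) => p q d0 d'0. field.
  by rewrite d0 d'0.
have [cg _] := hg.
rewrite circle_meanD ?circle_mean_cst; [|exact: ccontinuous_cst|exact: ccontinuousD cg (ccontinuousJ cg)].
rewrite circle_meanD // ?circle_meanJ ?g0 ?conjc0 ?addr0 //.
exact: ccontinuousJ cg.
Qed.

(** The common Blaschke factors have modulus one and cancel, and the factor of
    index k turns 1 / conj(1 - conj(a_k) z) into z / (1 - conj(a_k) z).  What
    remains is z times a function of the Hardy class. *)
Lemma circle_mean_TM_orth a k l : (1 <= k < l)%N -> (forall j, (1 <= j < l)%N -> cmod (a j) < 1) ->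
  circle_mean (fun z => TM a l z * (TM a k z)^*%C) = 0.
Proof.
move=> /andP[k1 kl] al; have xk : cmod (a k) < 1 by apply: al; rewrite k1.
pose g z := szego (a l) z * (szego (a k) z * \prod_(k.+1 <= j < l) ((z - a j) / (1 - (a j)^*%C * z))).
have hp : hardy (fun z => \prod_(k.+1 <= j < l) ((z - a j) / (1 - (a j)^*%C * z))).
  elim: l kl al {g} => [|l IH] // kl al.
  move: kl; rewrite ltnS leq_eqVlt => /predU1P[<-|kl].
    by apply: eq_hardy (hardy_cst 1) => t; rewrite big_geq.
  apply: (@eq_hardy _ (fun z => (z - a l) / (1 - (a l)^*%C * z) *
    \prod_(k.+1 <= j < l) ((z - a j) / (1 - (a j)^*%C * z)))).
    by move=> t; rewrite [RHS]big_nat_recr //= mulrC.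
  apply: hardy_blaschke; first by apply: al; rewrite (leq_trans k1 (ltnW kl)) /=.
  by apply: IH => // j /andP[j1 jl]; apply: al; rewrite j1 ltnW.
rewrite -(circle_mean_hardyMX (hardy_szegoM (a l) (hardy_szegoM (a k) hp))).
apply: eq_circle_mean => t; rewrite !TME !conjM.
have xt : (1 <= k < l)%N by rewrite k1.
rewrite {1}/blaschke (big_cat_nat (n := k)) //; last exact: ltnW.
rewrite -/(blaschke a k _) (big_ltn kl) mobius_circleE.
set P := \prod_(_ <= _ < l) _.
have bl : blaschke a k (expi t) * (blaschke a k (expi t))^*%C = 1.
  by apply: mul_conj_blaschke => j /andP[j1 jk]; apply: al; rewrite j1 (ltn_trans jk).
have d0 := mobius_denominator_neq0 xk (cmod_expi t).
rewrite conjc_inv conjc_real.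
have key (b b' d d' s r z p : R[i]) : b * b' = 1 -> d != 0 -> d' != 0 ->
    s * (b * (z * d' / d * p)) * (r / d' * b') = z * (s * (r / d * p)).
  move=> bb d1 d2; rewrite [LHS](_ : _ = (b * b') * (z * (s * (r / d * p)))).
    by rewrite bb mul1r.
  by field; rewrite d1 d2.
by apply: key => //; rewrite conj_eq0.
Qed.

(** The conjugate of the Fourier coefficient of index [j] of [u], which is the
    inner product of z^j with [u]. *)
Definition coeff (u : R[i] -> R[i]) j : R[i] := circle_mean (fun z => z ^+ j * (u z)^*%C).

Lemma circle_continuous_coeff u j : circle_continuous u ->
  circle_continuous (fun z => z ^+ j * (u z)^*%C).
Proof. by move=> cu; apply: circle_continuousM (ccontinuousJ cu); exact: circle_continuousX. Qed.

(** Expand (1 - conj(x) z) v = sqrt(1 - |x|^2) u, with v = szego x * u,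
    against z^j.  On the circle, multiplication by z shifts the coefficients
    by one, and the one of index 0 of z v vanishes as v is in the Hardy class.
    For |x| >= 1 both sides are zero. *)
Lemma coeff_szegoM x u j : hardy u ->
  coeff (fun z => szego x z * u z) j =
  (if j is i.+1 then x * coeff (fun z => szego x z * u z) i else 0) +
  (Num.sqrt (1 - cmod x ^+ 2))%:C%C * coeff u j.
Proof.
move=> hu; have [x1|x1] := ltP (cmod x) 1; last first.
  have zero i : coeff (fun z => szego x z * u z) i = 0.
    rewrite -[RHS]circle_mean_cst; apply: eq_circle_mean => t.
    by rewrite szego_out // mul0r conjc0 mulr0.
  by rewrite !zero sqrt_defect0 // rmorph0 mul0r; case: j => [|j]; rewrite ?zero ?mulr0 addr0.
set v := fun z => szego x z * u z.
have hv : hardy v := hardy_szegoM x hu.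
have [cu _] := hu; have [cv _] := hv.
have -> : (if j is i.+1 then x * coeff v i else 0)
    = x * circle_mean (fun z => z ^+ j * (z * v z)^*%C).
  case: j => [|j]; last first.
    congr (_ * _); apply: eq_circle_mean => t.
    by rewrite conjM expiJ exprSr mulrA mulfK ?expi_neq0.
  rewrite (@eq_circle_mean _ _ (fun z => (z * v z)^*%C)); last by move=> t; rewrite mul1r.
  have [czv _] := hardyMX hv.
  by rewrite circle_meanJ // circle_mean_hardyMX // conjc0 mulr0.
have czv : circle_continuous (fun z => z ^+ j * (z * v z)^*%C).
  by apply: circle_continuous_coeff; exact: ccontinuousM ccontinuous_expi cv.
have cju := circle_continuous_coeff j cu.
rewrite /coeff -!circle_meanZ // -circle_meanD //; [|exact: ccontinuousM (ccontinuous_cst _) _..].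
apply: eq_circle_mean => t; rewrite /v /szego.
have d0 := mobius_denominator_neq0 x1 (cmod_expi t).
have d'0 : 1 - x * (expi t)^-1 != 0 by rewrite -conj_mobius_denominator conj_eq0.
rewrite !conjM conjc_inv conjc_real conj_mobius_denominator expiJ.
(* The recursion pointwise on the circle, where w stands for the inverse of expi t. *)
have key (p w s r : R[i]) : 1 - x * w != 0 ->
   p * (s / (1 - x * w) * r) = x * (p * (w * (s / (1 - x * w) * r))) + s * (p * r).
  by move=> nz; field.
exact: key.
Qed.

(** By induction on [j] along the recursion [coeff_szegoM], whose terms are
    continuous in [X p] over the whole plane. *)
Lemma ccontinuous_coeff_szegoM (T : topologicalType) (X : T -> R[i]) u j :
  ccontinuous X -> hardy u -> ccontinuous (fun p => coeff (fun z => szego (X p) z * u z) j).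
Proof.
move=> cX hu.
(* The square root is continuous on the whole line, so nothing happens at |X p| = 1. *)
have cs c : ccontinuous (fun p => (Num.sqrt (1 - cmod (X p) ^+ 2))%:C%C * c).
  apply: ccontinuousM (ccontinuous_cst _); apply: ccontinuous_real => p.
  apply: (@continuous_comp _ _ _ (fun p => 1 - cmod (X p) ^+ 2) (@Num.sqrt R)).
    by apply: cvgB; [exact: cvg_cst|exact: continuous_sqr_cmod].
  exact: sqrt_continuous.
elim: j => [|j IH].
  by apply: eq_ccontinuous (cs (coeff u 0)) => p; rewrite (coeff_szegoM _ _ hu) add0r.
apply: eq_ccontinuous (ccontinuousD (ccontinuousM cX IH) (cs (coeff u j.+1))) => p.
by rewrite [RHS](coeff_szegoM _ _ hu).
Qed.

Definition set_last (a : nat -> R[i]) n x : nat -> R[i] := [eta a with n |-> x].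

Lemma blaschke_set_last a n k x : (k <= n)%N -> blaschke (set_last a n x) k = blaschke a k.
Proof.
move=> kn; apply/funext => z; apply: eq_big_nat => l /andP[_ lk].
by rewrite /set_last /= ltn_eqF // (leq_trans lk).
Qed.

Lemma TM_set_last a n x : TM (set_last a n x) n = fun z => szego x z * blaschke a n z.
Proof.
apply/funext => z; rewrite TME blaschke_set_last //.
by have -> : set_last a n x n = x by rewrite /set_last /= eqxx.
Qed.

Lemma TM_set_last_lt a n k x : (k < n)%N -> TM (set_last a n x) k = TM a k.
Proof.
move=> kn; apply/funext => z; rewrite !TME blaschke_set_last ?(ltnW kn) //.
by have -> : set_last a n x k = a k by rewrite /set_last /= (ltn_eqF kn).
Qed.

Lemma ccontinuous_coeff_TM (T : topologicalType) (X : T -> R[i]) a n k j :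
  (forall l, (1 <= l < n)%N -> cmod (a l) < 1) -> ccontinuous X -> (k <= n)%N ->
  ccontinuous (fun p => coeff (TM (set_last a n (X p)) k) j).
Proof.
move=> an cX; rewrite leq_eqVlt => /predU1P[->|kn].
  have hb := hardy_blaschke_prod an.
  apply: eq_ccontinuous (ccontinuous_coeff_szegoM j cX hb) => p.
  by rewrite TM_set_last.
apply: eq_ccontinuous (ccontinuous_cst (coeff (TM a k) j)) => p.
by rewrite TM_set_last_lt.
Qed.

End TakenakaMalmquist.

(** * Square-integrable functions on the torus *)

Section TorusMean.
Context {R : realType}.
Implicit Types (f g : R[i] * R[i] -> R[i]) (u v : R[i] -> R[i]).
Local Notation leb := (@lebesgue_measure R).
Local Notation arc := (`[(- pi : R), pi]%classic : set R).

Local Notation plane := (measurableTypeR R * measurableTypeR R)%type.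

Lemma measurable_square : @measurable _ plane (@square R).
Proof. by apply: measurableX; exact: measurable_itv. Qed.

Lemma leb2_square_lty : (@leb2 R (@square R) < +oo)%E.
Proof.
rewrite /leb2 /square product_measure1E; [|exact: measurable_itv..].
by rewrite /= lebesgue_measure_itv /= lte_fin ltNpipi -EFinB -EFinM ltry.
Qed.

Local Notation integrable2 := (@integrable.body _ plane R (@leb2 R) (@square R)).

(** The plane carries two sigma-algebra structures with the same measurable
    sets, one from the reals as a measurable type and one from the
    construction of the Lebesgue measure.  The identity map transports
    integrals from one to the other. *)
Lemma integrable_leb2P (h : R * R -> R) :
  (@leb2 R).-integrable (@square R) (EFin \o h) <-> integrable2 (EFin \o h).
Proof.
have mphi : measurable_fun setT (id : (measurableTypeR R * measurableTypeR R)%type -> ((R : measurableType _) * (R : measurableType _))%type).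
  exact: measurable_id.
have key : measurable_fun (@square R) h ->
  @integral _ ((R : measurableType _) * (R : measurableType _))%type R (@leb2 R) (@square R) (fun x => `|(h x)%:E|%E) =
  @integral _ (measurableTypeR R * measurableTypeR R)%type R (@leb2 R) (@square R) (fun x => `|(h x)%:E|%E).
  move=> mh.
  have := @ge0_integral_pushforward _ _ _ _ R _ mphi (@leb2 R) (@square R) (fun x => `|(h x)%:E|%E).
  apply.
  - by apply: measurableX; exact: measurable_itv.
  - by apply/measurable_EFinP; apply: measurableT_comp.
  - by [].
split=> /integrableP[mh Ih]; apply/integrableP; split=> //.
- by rewrite -key //; apply/measurable_EFinP.
- by rewrite key //; apply/measurable_EFinP.
Qed.

Lemma L2P f : L2 f <->
  [/\ measurable_fun (@square R) (fun x => complex.Re (f (torus x))),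
      measurable_fun (@square R) (fun x => complex.Im (f (torus x))) &
      integrable2 (EFin \o (fun x => cmod (f (torus x)) ^+ 2))].
Proof. by split=> -[mr mi /integrable_leb2P]. Qed.

Lemma measurable_tensor (p q : R -> R) : continuous p -> continuous q ->
  measurable_fun (@square R) (fun x => p x.1 * q x.2).
Proof.
move=> cp cq; apply: measurable_funTS; apply: measurable_funM.
  by apply: measurableT_comp measurable_fst; exact: continuous_measurable_fun.
by apply: measurableT_comp measurable_snd; exact: continuous_measurable_fun.
Qed.

Lemma continuous_bounded_arc (p : R -> R) : continuous p ->
  exists2 K, 0 <= K & forall t, arc t -> `|p t| <= K.
Proof.
move=> cp.
have /compact_bounded[K [_ HK]] : compact (p @` arc)%classic.
  by apply: continuous_compact; [exact: continuous_subspaceT|exact: segment_compact].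
exists (`|K| + 1); first by rewrite addr_ge0.
move=> t At; apply: (HK (`|K| + 1)); last by exists t.
by rewrite (le_lt_trans (ler_norm K)) // ltrDl.
Qed.

Lemma integrable_tensor (p q : R -> R) : continuous p -> continuous q ->
  integrable2 (EFin \o (fun x => p x.1 * q x.2)).
Proof.
move=> cp cq; apply: measurable_bounded_integrable.
- exact: measurable_square.
- exact: leb2_square_lty.
- exact: measurable_tensor.
have [K K0 pK] := continuous_bounded_arc cp.
have [L L0 qL] := continuous_bounded_arc cq.
exists (K * L); split; first exact: num_real.
move=> M KLM x [x1 x2] /=; apply: le_trans (ltW KLM).
by rewrite normrM ler_pM // ?pK ?qL.
Qed.

(** Fubini's theorem for the functions extended by zero outside the square. *)
Lemma Rintegral_tensor (p q : R -> R) : continuous p -> continuous q ->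
  Rintegral (@leb2 R) (@square R) (fun x => p x.1 * q x.2) =
  Rintegral leb arc p * Rintegral leb arc q.
Proof.
move=> cp cq.
have Ip := continuous_integrable_arc cp; have Iq := continuous_integrable_arc cq.
have E : ((fun x : R * R => p x.1 * q x.2) \_ (@square R) =
         (fun x => (p \_ arc) x.1 * (q \_ arc) x.2))%classic.
  apply/funext => -[s t]; rewrite !patchE /square /= in_setX /=.
  by case: (s \in _); case: (t \in _); rewrite /= ?mulr0 ?mul0r.
have I2 : @integrable.body _ plane R (@leb2 R) setT
    (EFin \o (fun x => (p \_ arc)%classic x.1 * (q \_ arc)%classic x.2)).
  rewrite -E; rewrite -restrict_EFin; 
  by apply/(@integrable_mkcond _ plane R (@leb2 R) _ _ measurable_square); exact: integrable_tensor.
have Iq' : leb.-integrable setT (EFin \o (q \_ arc))%classic.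
  by rewrite -restrict_EFin; apply/(@integrable_mkcond _ (measurableTypeR R) R leb _ _ measurable_arc).
have Ip' : leb.-integrable setT (EFin \o (p \_ arc))%classic.
  by rewrite -restrict_EFin; apply/(@integrable_mkcond _ (measurableTypeR R) R leb _ _ measurable_arc).
rewrite Rintegral_mkcond E [in RHS]Rintegral_mkcond [X in _ * X]Rintegral_mkcond.
rewrite {1}/Rintegral /leb2 -integral12_prod_meas1 //.
rewrite (eq_integral (fun s : measurableTypeR R => ((Rintegral leb setT (q \_ arc)%classic) * (p \_ arc)%classic s)%:E)); last first.
  move=> s _; rewrite /fubini_F /=.
  under eq_integral do rewrite EFinM.
  rewrite integralZl // mulrC EFinM /Rintegral fineK //.
  exact: integrable_fin_num Iq'.
rewrite mulrC; exact: (RintegralZl _ measurableT Ip').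
Qed.

Lemma torus_meanE f : torus_mean f =
  ((4 * pi ^+ 2)^-1)%:C%C * cint (@leb2 R) (@square R) (f \o @torus R).
Proof. by apply: complex_ext; rewrite ?Re_mulc ?Im_mulc /= mul0r ?subr0 ?addr0. Qed.

Lemma torus_mean_tensor u v : circle_continuous u -> circle_continuous v ->
  torus_mean (fun p => u p.1 * v p.2) = circle_mean u * circle_mean v.
Proof.
move=> [ru iu] [rv iv]; rewrite torus_meanE /circle_mean mulrACA; congr (_ * _).
  rewrite -rmorphM /=; congr (_%:C)%C; rewrite -invfM; congr (_^-1); ring.
apply: complex_ext; rewrite ?Re_mulc ?Im_mulc /cint /= -!Rintegral_tensor //.
  rewrite -RintegralB; [|exact: measurable_square|exact (integrable_tensor ru rv)|exact (integrable_tensor iu iv)].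
  by apply: eq_Rintegral => x _; rewrite Re_mulc.
rewrite -RintegralD; [|exact: measurable_square|exact (integrable_tensor ru iv)|exact (integrable_tensor iu rv)].
by apply: eq_Rintegral => x _; rewrite Im_mulc.
Qed.

Lemma eq_L2 f g : f =1 g -> L2 f -> L2 g.
Proof. by move=> /funext ->. Qed.

Lemma L2_tensor u v : circle_continuous u -> circle_continuous v ->
  L2 (fun p => u p.1 * v p.2).
Proof.
move=> cu cv; have [ru iu] := cu; have [rv iv] := cv; apply/L2P; split.
- under eq_fun do rewrite Re_mulc.
  by apply: measurable_funB; [exact (measurable_tensor ru rv)|exact (measurable_tensor iu iv)].
- under eq_fun do rewrite Im_mulc.
  by apply: measurable_funD; [exact (measurable_tensor ru iv)|exact (measurable_tensor iu rv)].
- have := integrable_tensor (continuous_sqr_cmod cu) (continuous_sqr_cmod cv).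
  by apply: eq_integrable; [exact: measurable_square|move=> x _ /=; rewrite cmodM exprMn].
Qed.

Lemma L2D f g : L2 f -> L2 g -> L2 (fun p => f p + g p).
Proof.
move=> /L2P[rf xf If] /L2P[rg xg Ig]; apply/L2P.
have mr : measurable_fun (@square R) (fun x => complex.Re (f (torus x) + g (torus x))).
  by under eq_fun do rewrite Re_addc; apply: measurable_funD.
have mi : measurable_fun (@square R) (fun x => complex.Im (f (torus x) + g (torus x))).
  by under eq_fun do rewrite Im_addc; apply: measurable_funD.
split=> //.
have I2 : integrable2 (EFin \o (fun x => 2 * cmod (f (torus x)) ^+ 2 + 2 * cmod (g (torus x)) ^+ 2)).
  by apply: rintegrableD; [exact: measurable_square|apply: rintegrableZ => //; exact: measurable_square..].
apply: le_integrable I2; first exact: measurable_square.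
  apply/measurable_EFinP; under eq_fun do rewrite sqr_cmod.
  by apply: measurable_funD; apply: measurable_funX.
move=> x _ /=; rewrite lee_fin !ger0_norm ?addr_ge0 ?mulr_ge0 ?sqr_ge0 ?cmod_ge0 //.
exact: sqr_cmodD_le.
Qed.

Lemma L2Z c f : L2 f -> L2 (fun p => c * f p).
Proof.
move=> /L2P[rf xf If]; apply/L2P; split.
- under eq_fun do rewrite Re_mulc.
  by apply: measurable_funB; apply: measurable_funM.
- under eq_fun do rewrite Im_mulc.
  by apply: measurable_funD; apply: measurable_funM.
- have := rintegrableZ measurable_square (cmod c ^+ 2) If.
  by apply: eq_integrable; [exact: measurable_square|move=> x _ /=; rewrite cmodM exprMn].
Qed.

Lemma L2_sum (I : Type) (r : seq I) (P : pred I) (F : I -> R[i] * R[i] -> R[i]) :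
  (forall i, P i -> L2 (F i)) -> L2 (fun p => \sum_(i <- r | P i) F i p).
Proof.
move=> LF; elim: r => [|i r IH].
  apply: eq_L2 (@L2_tensor (fun=> 0) (fun=> 0) (ccontinuous_cst 0) (ccontinuous_cst 0)) => p.
  by rewrite big_nil mulr0.
case Pi: (P i).
  by apply: eq_L2 (L2D (LF i Pi) IH) => p; rewrite big_cons Pi.
by apply: eq_L2 IH => p; rewrite big_cons Pi.
Qed.

Lemma L2_cintegrable f g : L2 f -> L2 g ->
  cintegrable (@leb2 R) (@square R) (fun x => f (torus x) * (g (torus x))^*%C).
Proof.
move=> Lf Lg; have /L2P[rf xf If] := Lf; have /L2P[rg xg Ig] := Lg.
apply: (le_cintegrable measurable_square _ _ (rintegrableD measurable_square If Ig)).
- under eq_fun do rewrite Re_mulc Re_conjc Im_conjc mulrN opprK.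
  by apply: measurable_funD; apply: measurable_funM.
- under eq_fun do rewrite Im_mulc Re_conjc Im_conjc mulrN.
  apply: measurable_funD; last exact: measurable_funM.
  by apply: measurableT_comp => //; exact: measurable_funM.
- by move=> x; rewrite -[cmod (g _)]cmodJ; exact: cmod_mul_le.
Qed.

Lemma eq_inner f1 f2 g1 g2 : f1 =1 f2 -> g1 =1 g2 -> inner f1 g1 = inner f2 g2.
Proof. by move=> /funext -> /funext ->. Qed.

Lemma innerDl f1 f2 g : L2 f1 -> L2 f2 -> L2 g ->
  inner (fun p => f1 p + f2 p) g = inner f1 g + inner f2 g.
Proof.
move=> L1 L2' Lg; rewrite /inner !torus_meanE -mulrDr; congr (_ * _).
rewrite -cintD; [|exact: measurable_square|exact: L2_cintegrable..].
by apply: eq_cint => x /=; rewrite mulrDl.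
Qed.

Lemma innerZl c f g : L2 f -> L2 g -> inner (fun p => c * f p) g = c * inner f g.
Proof.
move=> Lf Lg; rewrite /inner !torus_meanE [RHS]mulrCA; congr (_ * _).
rewrite -cintZ; [|exact: measurable_square|exact: L2_cintegrable].
by apply: eq_cint => x /=; rewrite mulrA.
Qed.

Lemma innerC f g : L2 f -> L2 g -> inner g f = (inner f g)^*%C.
Proof.
move=> Lf Lg; rewrite /inner !torus_meanE conjM conjc_real; congr (_ * _).
rewrite -cintJ; [|exact: measurable_square|exact: L2_cintegrable].
by apply: eq_cint => x /=; rewrite conjM conjcK mulrC.
Qed.

Lemma innerDr f g1 g2 : L2 f -> L2 g1 -> L2 g2 ->
  inner f (fun p => g1 p + g2 p) = inner f g1 + inner f g2.
Proof.
move=> Lf L1 L2'; have L12 := L2D L1 L2'.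
by rewrite (innerC L12 Lf) innerDl // conjD -!innerC.
Qed.

Lemma innerZr c f g : L2 f -> L2 g -> inner f (fun p => c * g p) = c^*%C * inner f g.
Proof.
move=> Lf Lg; have Lcg := L2Z c Lg.
by rewrite (innerC Lcg Lf) innerZl // conjM -innerC.
Qed.

Lemma inner_suml (I : Type) (r : seq I) (P : pred I) (F : I -> R[i] * R[i] -> R[i]) g :
  (forall i, P i -> L2 (F i)) -> L2 g ->
  inner (fun p => \sum_(i <- r | P i) F i p) g = \sum_(i <- r | P i) inner (F i) g.
Proof.
move=> LF Lg; elim: r => [|i r IH].
  have Lg0 : L2 (fun p => 0 * g p) by exact: L2Z.
  rewrite big_nil -[RHS](mul0r (inner g g)) -innerZl //.
  by apply: eq_inner => p //; rewrite big_nil mul0r.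
rewrite big_cons; case: ifPn => Pi.
  have LFi := LF i Pi; have Ls : L2 (fun p => \sum_(j <- r | P j) F j p) by exact: L2_sum.
  rewrite -IH -innerDl //.
  by apply: eq_inner => p //; rewrite big_cons Pi.
by rewrite -IH; apply: eq_inner => p //; rewrite big_cons (negbTE Pi).
Qed.

Lemma inner_ge0 f : L2 f -> 0 <= complex.Re (inner f f).
Proof.
move=> Lf; rewrite /inner torus_meanE Re_mulc /= mul0r subr0 mulr_ge0 //.
  by rewrite invr_ge0 mulr_ge0 ?sqr_ge0.
by apply: Rintegral_ge0 => x _ /=; rewrite mulcJ /= sqr_ge0.
Qed.

Lemma sqr_l2norm f : L2 f -> l2norm f ^+ 2 = complex.Re (inner f f).
Proof. by move=> Lf; rewrite /l2norm sqr_sqrtr // inner_ge0. Qed.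

Lemma inner_tensor u1 v1 u2 v2 : circle_continuous u1 -> circle_continuous v1 ->
  circle_continuous u2 -> circle_continuous v2 ->
  inner (fun p => u1 p.1 * v1 p.2) (fun p => u2 p.1 * v2 p.2) =
  circle_mean (fun z => u1 z * (u2 z)^*%C) * circle_mean (fun z => v1 z * (v2 z)^*%C).
Proof.
move=> cu1 cv1 cu2 cv2; rewrite -torus_mean_tensor; last 2 first.
- exact: ccontinuousM cu1 (ccontinuousJ cu2).
- exact: ccontinuousM cv1 (ccontinuousJ cv2).
by congr torus_mean; apply/funext => p; rewrite conjM mulrACA.
Qed.

(** Bessel's inequality for a single unit vector: f - <f, g> g has squared
    norm |f|^2 - |<f, g>|^2, which is nonnegative. *)
Lemma bessel1 f g : L2 f -> L2 g -> inner g g = 1 -> cmod (inner f g) <= l2norm f.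
Proof.
move=> Lf Lg gg; rewrite -(ler_pXn2r (n := 2)) ?nnegrE ?cmod_ge0 ?sqrtr_ge0 //.
set c := inner f g.
have Lcg : L2 (fun p => - c * g p) by exact: L2Z.
have LL := L2D Lf Lcg.
have := inner_ge0 LL.
rewrite innerDl // !innerDr // !innerZr // !innerZl // (innerC Lf Lg) gg -/c sqr_l2norm //.
rewrite [X in complex.Re X](_ : _ = inner f f - (cmod c ^+ 2)%:C%C); last first.
  by rewrite -mulcJ [(- c)^*%C](rmorphN conjc); ring.
by rewrite Re_addc /= subr_ge0.
Qed.

Lemma pythagoras (I : eqType) (r : seq I) (c : I -> R[i]) (e : I -> R[i] * R[i] -> R[i]) :
  uniq r -> (forall i, i \in r -> L2 (e i)) ->
  (forall i j, i \in r -> j \in r -> inner (e i) (e j) = (i == j)%:R) ->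
  l2norm (fun p => \sum_(i <- r) c i * e i p) ^+ 2 = \sum_(i <- r) cmod (c i) ^+ 2.
Proof.
move=> ur Le orth.
have sumE F : (fun p : R[i] * R[i] => \sum_(i <- r) F i p) = fun p => \sum_(i <- r | i \in r) F i p.
  by apply/funext => p; rewrite [LHS]big_seq.
have Lce i : i \in r -> L2 (fun p => c i * e i p) by move=> ir; exact/L2Z/Le.
have Ls : L2 (fun p => \sum_(i <- r) c i * e i p).
  by rewrite sumE; exact: L2_sum.
rewrite sqr_l2norm //.
have dual i : i \in r -> inner (e i) (fun p => \sum_(i <- r) c i * e i p) = (c i)^*%C.
  move=> ir; rewrite (innerC Ls (Le i ir)).
  suff -> : inner (fun p => \sum_(i <- r) c i * e i p) (e i) = c i by [].
  rewrite sumE (inner_suml r Lce (Le i ir)) -big_seq (bigD1_seq i) //=.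
  rewrite (innerZl _ (Le i ir) (Le i ir)) orth // eqxx mulr1 big_seq_cond big1 ?addr0 // => j /andP[jr ji].
  by rewrite (innerZl _ (Le j jr) (Le i ir)) orth // (negbTE ji) mulr0.
rewrite {1}sumE (inner_suml r Lce Ls).
rewrite (eq_bigr (fun i => (cmod (c i) ^+ 2)%:C%C)); last first.
  by move=> i ir; rewrite (innerZl _ (Le i ir) Ls) dual // mulcJ.
rewrite [RHS]big_seq.
by elim/big_rec2: _ => //= i x z _ <-; rewrite Re_addc.
Qed.

End TorusMean.

(** * The product system and its energy *)

Section BigShell.
Variables (V : zmodType) (F : nat -> nat -> V).

Lemma sum_square_shell n : (1 <= n)%N ->
  \sum_(1 <= k < n.+1) \sum_(1 <= l < n.+1) F k l - \sum_(1 <= k < n) \sum_(1 <= l < n) F k l =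
  \sum_(1 <= k < n.+1) \sum_(1 <= l < n.+1 | maxn k l == n) F k l.
Proof.
move=> n1; rewrite big_nat_recr //= [RHS]big_nat_recr //=.
have -> : \sum_(1 <= l < n.+1 | maxn n l == n) F n l = \sum_(1 <= l < n.+1) F n l.
  rewrite big_nat_cond [RHS]big_nat_cond; apply: eq_bigl => l.
  rewrite ltnS andbT; case: (boolP (1 <= l <= n)%N) => //= /andP[_ ln].
  by rewrite (maxn_idPl ln) eqxx.
rewrite addrAC; congr (_ + _).
rewrite -sumrB; apply: eq_big_nat => k /andP[k1 kn].
rewrite big_nat_recr //= addrAC subrr add0r [RHS]big_mkcond big_nat_recr //=.
rewrite (maxn_idPr (ltnW kn)) eqxx big_nat big1 ?add0r // => l /andP[_ ln].
by rewrite ltn_eqF // gtn_max kn.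
Qed.

Definition shell n : seq (nat * nat) :=
  [seq (k, l) | k <- index_iota 1 n.+1, l <- [seq l <- index_iota 1 n.+1 | maxn k l == n]].

Lemma big_shell n :
  \sum_(i <- shell n) F i.1 i.2 =
  \sum_(1 <= k < n.+1) \sum_(1 <= l < n.+1 | maxn k l == n) F k l.
Proof.
rewrite big_allpairs_dep; apply: eq_bigr => k _.
by rewrite big_filter.
Qed.

End BigShell.

Lemma mem_shell n i : i \in shell n -> (1 <= i.1 <= n)%N /\ (1 <= i.2 <= n)%N.
Proof.
move=> /allpairsPdep[k [l [kn]]]; rewrite mem_filter => /andP[_ ln] -> /=.
by move: kn ln; rewrite !mem_index_iota !ltnS.
Qed.

Lemma uniq_shell n : uniq (shell n).
Proof.
apply: allpairs_uniq_dep; first exact: iota_uniq.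
  by move=> k _; apply: filter_uniq; exact: iota_uniq.
by move=> [k l] [k' l'] _ _ /= [-> ->].
Qed.

Section ProductTM.
Context {R : realType}.
Implicit Types (a b : nat -> R[i]) (f g : R[i] * R[i] -> R[i]) (x y : R[i]).

Lemma circle_continuous_TM a k : (forall j, (1 <= j < k)%N -> cmod (a j) < 1) ->
  circle_continuous (TM a k).
Proof. by move=> ak; have [] := hardy_TM ak. Qed.

Lemma L2_TM2 a b k l : (forall j, (1 <= j < k)%N -> cmod (a j) < 1) ->
  (forall j, (1 <= j < l)%N -> cmod (b j) < 1) -> L2 (TM2 a b k l).
Proof. by move=> ak bl; apply: L2_tensor; exact: circle_continuous_TM. Qed.

Lemma circle_mean_TM a n k k' : (forall j, (1 <= j <= n)%N -> cmod (a j) < 1) ->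
  (1 <= k <= n)%N -> (1 <= k' <= n)%N ->
  circle_mean (fun z => TM a k z * (TM a k' z)^*%C) = (k == k')%:R.
Proof.
move=> an.
have sub m j : (m <= n)%N -> (1 <= j < m)%N -> cmod (a j) < 1.
  by move=> mn /andP[j1 jm]; apply: an; rewrite j1 (leq_trans (ltnW jm)).
have key i j : (1 <= i)%N -> (i < j <= n)%N ->
    circle_mean (fun z => TM a j z * (TM a i z)^*%C) = 0.
  move=> i1 /andP[ij jn]; apply: circle_mean_TM_orth; first by rewrite i1.
  by move=> m; exact: sub.
move=> /andP[k1 kn] /andP[k'1 k'n]; have [kk|kk|<-] := ltngtP k k'.
- have cc : circle_continuous (fun z => TM a k' z * (TM a k z)^*%C).
    by apply: ccontinuousM; [|apply: ccontinuousJ];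
      apply: circle_continuous_TM => j; exact: sub.
  rewrite -[RHS]conjc0 -(key k k') ?kk // -circle_meanJ //.
  by apply: eq_circle_mean => t; rewrite [RHS]conjM conjcK mulrC.
- by rewrite key ?kk.
- by rewrite circle_mean_TM_norm // => [j|]; [exact: sub|apply: an; rewrite k1].
Qed.

Lemma inner_TM2 a b n k l k' l' : (forall j, (1 <= j <= n)%N -> cmod (a j) < 1) ->
  (forall j, (1 <= j <= n)%N -> cmod (b j) < 1) ->
  (1 <= k <= n)%N -> (1 <= l <= n)%N -> (1 <= k' <= n)%N -> (1 <= l' <= n)%N ->
  inner (TM2 a b k l) (TM2 a b k' l') = ((k, l) == (k', l'))%:R.
Proof.
move=> an bn kn ln kn' ln'.
have cTM (c : nat -> R[i]) m : (forall j, (1 <= j <= n)%N -> cmod (c j) < 1) -> (1 <= m <= n)%N ->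
    circle_continuous (TM c m).
  move=> cn /andP[_ mn]; apply: circle_continuous_TM => j /andP[j1 jm].
  by apply: cn; rewrite j1 (leq_trans (ltnW jm)).
rewrite inner_tensor; [|exact: cTM..].
by rewrite !(circle_mean_TM (n := n)) // xpair_eqE -natrM mulnb.
Qed.

Lemma sqr_l2norm_Dn a b n f : (1 <= n)%N ->
  (forall j, (1 <= j <= n)%N -> cmod (a j) < 1) ->
  (forall j, (1 <= j <= n)%N -> cmod (b j) < 1) ->
  l2norm (Dn a b n f) ^+ 2 =
  \sum_(1 <= k < n.+1) \sum_(1 <= l < n.+1 | maxn k l == n) cmod (inner f (TM2 a b k l)) ^+ 2.
Proof.
move=> n1 an bn; rewrite -(big_shell (fun k l => cmod (inner f (TM2 a b k l)) ^+ 2)).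
have -> : Dn a b n f =
    fun p => \sum_(i <- shell n) inner f (TM2 a b i.1 i.2) * TM2 a b i.1 i.2 p.
  apply/funext => p.
  rewrite (big_shell (fun k l => inner f (TM2 a b k l) * TM2 a b k l p)).
  by rewrite -sum_square_shell // /Dn /Sn prednK.
apply: (pythagoras (fun i => inner f (TM2 a b i.1 i.2))
                   (e := fun i => TM2 a b i.1 i.2)).
- exact: uniq_shell.
- move=> [k l] /mem_shell /= [/andP[_ kn] /andP[_ ln]]; apply: L2_TM2 => j /andP[j1 jk].
    by apply: an; rewrite j1 (leq_trans (ltnW jk)).
  by apply: bn; rewrite j1 (leq_trans (ltnW jk)).
- move=> [k l] [k' l'] /mem_shell /= [kn ln] /mem_shell /= [kn' ln'].
  exact: (inner_TM2 (n := n)).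
Qed.

Lemma TM_out a k z : 1 <= cmod (a k) -> TM a k z = 0.
Proof. by move=> ak; rewrite TME szego_out // mul0r. Qed.

Lemma inner0r f g : (forall p, g p = 0) -> inner f g = 0.
Proof.
move=> g0; have -> : g = fun p => 0 * g p by apply/funext => p; rewrite mul0r.
rewrite /inner torus_meanE -[RHS](mulr0 ((4 * pi ^+ 2)^-1)%:C%C); congr (_ * _).
rewrite (@eq_cint _ _ _ _ _ _ (fun=> 0)); last by move=> x /=; rewrite mul0r conjc0 mulr0.
by apply: complex_ext; rewrite /cint /= Rintegral_cst ?mul0r //; exact: measurable_square.
Qed.

(** Either the last parameters lie in the disc and the product is a unit
    vector, or the product is zero.  The bound is therefore uniform over all
    parameters, including those outside the disc. *)
Lemma inner_TM2_bound a b k l f : L2 f -> (1 <= k)%N -> (1 <= l)%N ->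
  (forall j, (1 <= j < k)%N -> cmod (a j) < 1) ->
  (forall j, (1 <= j < l)%N -> cmod (b j) < 1) ->
  cmod (inner f (TM2 a b k l)) <= l2norm f.
Proof.
move=> Lf k1 l1 ak bl.
have [ak1|ak1] := ltP (cmod (a k)) 1; last first.
  by rewrite inner0r ?cmod0 ?sqrtr_ge0 // => p; rewrite /TM2 TM_out // mul0r.
have [bl1|bl1] := ltP (cmod (b l)) 1; last first.
  by rewrite inner0r ?cmod0 ?sqrtr_ge0 // => p; rewrite /TM2 (TM_out _ bl1) mulr0.
apply: bessel1 => //; first exact: L2_TM2.
rewrite inner_tensor; [|exact: circle_continuous_TM..].
by rewrite !circle_mean_TM_norm // mulr1.
Qed.

(** If f is a polynomial, the inner product is a finite combination of
    products of coefficients, which are continuous in the parameters.  In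
    general f is an L^2 limit of polynomials, and by [inner_TM2_bound] the
    inner products converge uniformly in the parameters. *)
Lemma ccontinuous_inner_TM2 (T : topologicalType) (X Y : T -> R[i]) a b n k l f :
  (forall j, (1 <= j < n)%N -> cmod (a j) < 1) ->
  (forall j, (1 <= j < n)%N -> cmod (b j) < 1) ->
  ccontinuous X -> ccontinuous Y -> (1 <= k <= n)%N -> (1 <= l <= n)%N -> H2 f ->
  ccontinuous (fun p => inner f (TM2 (set_last a n (X p)) (set_last b n (Y p)) k l)).
Proof.
move=> an bn cX cY /andP[k1 kn] /andP[l1 ln] [Lf [c fc]].
have small (u : nat -> R[i]) m (x : R[i]) j : (forall i, (1 <= i < n)%N -> cmod (u i) < 1) -> (m <= n)%N ->
    (1 <= j < m)%N -> cmod (set_last u n x j) < 1.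
  move=> un mn /andP[j1 jm]; have jn : (j < n)%N by apply: leq_trans mn.
  by rewrite /set_last /= (ltn_eqF jn) un // j1.
apply: ccontinuous_uniform_limit => e e0.
have /cvgrPdist_le/(_ _ e0)[N _ /(_ N (leqnn _))] := fc.
rewrite sub0r normrN ger0_norm ?sqrtr_ge0 //= => fN.
pose mono i j (p : R[i] * R[i]) : R[i] := p.1 ^+ i * p.2 ^+ j.
pose P p := \sum_(i < N) \sum_(j < N) c i j * mono i j p.
have Lmono i j : L2 (mono i j).
  by apply: (L2_tensor (u := fun z => z ^+ i) (v := fun z => z ^+ j));
    exact: circle_continuousX.
have Lcm i j : L2 (fun p => c i j * mono i j p) by exact: L2Z.
have LP1 (i : 'I_N) : L2 (fun p => \sum_(j < N) c i j * mono i j p).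
  by apply: L2_sum => j _.
have LP : L2 P by apply: L2_sum => i _.
have LNP : L2 (fun p => - 1 * P p) by exact: L2Z.
have fPE : (fun p => f p - \sum_(i < N) \sum_(j < N) c i j * p.1 ^+ i * p.2 ^+ j)
         = fun p => f p + -1 * P p.
  apply/funext => p; rewrite mulN1r; congr (_ - _).
  by apply: eq_bigr => i _; apply: eq_bigr => j _; rewrite mulrA.
rewrite fPE in fN.
exists (fun p => inner P (TM2 (set_last a n (X p)) (set_last b n (Y p)) k l)).
  apply: (@eq_ccontinuous _ _ (fun p => \sum_(i < N) \sum_(j < N) c i j *
    (coeff (TM (set_last a n (X p)) k) i * coeff (TM (set_last b n (Y p)) l) j))).
    move=> p.
    have Le : L2 (TM2 (set_last a n (X p)) (set_last b n (Y p)) k l).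
      by apply: L2_TM2 => j; exact: small.
    rewrite inner_suml //; apply: eq_bigr => i _.
    rewrite inner_suml //; apply: eq_bigr => j _.
    rewrite innerZl //; congr (_ * _).
    rewrite /coeff -(@inner_tensor _ (fun z => z ^+ i) (fun z => z ^+ j)) //.
    - exact: circle_continuousX.
    - exact: circle_continuousX.
    - by apply: circle_continuous_TM => m; exact: small.
    - by apply: circle_continuous_TM => m; exact: small.
  apply: ccontinuous_sum => i; apply: ccontinuous_sum => j.
  apply: ccontinuousM; first exact: ccontinuous_cst.
  by apply: ccontinuousM; exact: ccontinuous_coeff_TM.
move=> p.
have Le : L2 (TM2 (set_last a n (X p)) (set_last b n (Y p)) k l).
  by apply: L2_TM2 => j; exact: small.
set e2 := TM2 _ _ k l in Le *.
have -> : inner f e2 - inner P e2 = inner (fun p => f p + -1 * P p) e2.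
  by rewrite innerDl // innerZl // mulN1r.
apply: le_trans fN.
apply: inner_TM2_bound => //; [exact: L2D|move=> j; exact: small..].
Qed.

(** The quantity to maximize, defined for all complex parameters so that the
    maximum can be sought on a compact set. *)
Definition energy a b n f x y : R :=
  \sum_(1 <= k < n.+1) \sum_(1 <= l < n.+1 | maxn k l == n)
    cmod (inner f (TM2 (set_last a n x) (set_last b n y) k l)) ^+ 2.

(** Parameters outside the open disc are sent to 0; any point of the disc
    would do. *)
Definition retract x : R[i] := if cmod x < 1 then x else 0.

Lemma cmod_retract x : cmod (retract x) < 1.
Proof. by rewrite /retract; case: ifP => // _; rewrite cmod0. Qed.

Lemma TM_retract_or_zero a n k x :  (k <= n)%N ->
  TM (set_last a n x) k = TM (set_last a n (retract x)) k \/ forall z, TM (set_last a n x) k z = 0.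
Proof.
rewrite leq_eqVlt => /predU1P[->|kn]; last by left; rewrite !TM_set_last_lt.
rewrite /retract; case: ltP => x1; first by left.
by right=> z; rewrite TM_set_last szego_out ?mul0r.
Qed.

(** Each term either involves a parameter outside the disc, and is then zero,
    or is unchanged by the retraction. *)
Lemma energy_retract a b n f x y : energy a b n f x y <= energy a b n f (retract x) (retract y).
Proof.
rewrite /energy !big_nat; apply: ler_sum => k /andP[_ kn].
rewrite big_nat_cond [leRHS]big_nat_cond; apply: ler_sum => l /andP[/andP[_ ln] _].
rewrite ltnS in kn; rewrite ltnS in ln.
have zero g : (forall p, g p = 0) -> cmod (inner f g) ^+ 2 <=
    cmod (inner f (TM2 (set_last a n (retract x)) (set_last b n (retract y)) k l)) ^+ 2.
  by move=> g0; rewrite (inner0r f g0) cmod0 expr0n sqr_ge0.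
have [ax|ax] := TM_retract_or_zero a x kn; last by apply: zero => p; rewrite /TM2 ax mul0r.
have [by_|by_] := TM_retract_or_zero b y ln; last by apply: zero => p; rewrite /TM2 by_ mulr0.
by rewrite /TM2 ax by_.
Qed.

Lemma continuous_sum_nat (T : topologicalType) (m n : nat) (P : pred nat) (F : nat -> T -> R) :
  (forall i, (m <= i < n)%N -> continuous (F i)) ->
  continuous (fun p => \sum_(m <= i < n | P i) F i p).
Proof.
move=> cF; rewrite (_ : (fun p => _) =
    fun p => \sum_(i <- index_iota m n | (m <= i < n)%N && P i) F i p); last first.
  by apply/funext => p; rewrite big_nat_cond.
elim: (index_iota m n) => [|i r IH] p.
  rewrite (_ : (fun p => _) = fun=> 0); first exact: cvg_cst.
  by apply/funext => q; rewrite big_nil.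
case Pi: ((m <= i < n)%N && P i); last first.
  rewrite (_ : (fun p => _) = fun p => \sum_(i <- r | (m <= i < n)%N && P i) F i p).
    exact: IH.
  by apply/funext => q; rewrite big_cons Pi.
rewrite (_ : (fun p => _) = fun p => F i p + \sum_(i <- r | (m <= i < n)%N && P i) F i p).
  by apply: cvgD; [apply: cF; case/andP: Pi|exact: IH].
by apply/funext => q; rewrite big_cons Pi.
Qed.

Lemma continuous_energy (T : topologicalType) (X Y : T -> R[i]) a b n f :
  (forall j, (1 <= j < n)%N -> cmod (a j) < 1) ->
  (forall j, (1 <= j < n)%N -> cmod (b j) < 1) ->
  ccontinuous X -> ccontinuous Y -> H2 f ->
  continuous (fun p => energy a b n f (X p) (Y p)).
Proof.
move=> an bn cX cY Hf; apply: continuous_sum_nat => k kn.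
apply: continuous_sum_nat => l ln; apply: continuous_sqr_cmod.
exact: ccontinuous_inner_TM2.
Qed.

(** The maximum over the cube of side [-1, 1] in the real coordinates of x and
    y, which contains the bidisc, is moved into the bidisc by the
    retraction. *)
Lemma energy_max a b n f :
  (forall j, (1 <= j < n)%N -> cmod (a j) < 1) ->
  (forall j, (1 <= j < n)%N -> cmod (b j) < 1) -> H2 f ->
  exists x y, [/\ cmod x < 1, cmod y < 1 & forall x' y', cmod x' < 1 -> cmod y' < 1 ->
    energy a b n f x' y' <= energy a b n f x y].
Proof.
move=> an bn Hf.
pose X (p : (R * R) * (R * R)) : R[i] := (p.1.1 +i* p.1.2)%C.
pose Y (p : (R * R) * (R * R)) : R[i] := (p.2.1 +i* p.2.2)%C.
have c1 (U V : topologicalType) : continuous (fst : U * V -> U) by move=> p; exact: cvg_fst.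
have c2 (U V : topologicalType) : continuous (snd : U * V -> V) by move=> p; exact: cvg_snd.
have cX : ccontinuous X.
  split=> p; [exact: (continuous_comp (c1 _ _ p) (c1 _ _ _))|].
  exact: (continuous_comp (c1 _ _ p) (c2 _ _ _)).
have cY : ccontinuous Y.
  split=> p; [exact: (continuous_comp (c2 _ _ p) (c1 _ _ _))|].
  exact: (continuous_comp (c2 _ _ p) (c2 _ _ _)).
pose I : set R := `[(-1 : R), 1]%classic.
have cI : compact I by exact: segment_compact.
pose Q := ((I `*` I) `*` (I `*` I))%classic.
have cQ : compact Q by apply: compact_setX; apply: compact_setX.
have I0 : I 0 by rewrite /I /= in_itv /= lerN10 ler01.
have Q0 : (Q !=set0)%classic by exists ((0, 0), (0, 0)).
have [q _ qmax] := compact_EVT_max Q0 cQ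
  (continuous_subspaceT (continuous_energy an bn cX cY Hf)).
exists (retract (X q)), (retract (Y q)); split; [exact: cmod_retract..|].
move=> x y x1 y1; apply: le_trans (energy_retract _ _ _ _ _ _).
have inI (r : R) z : `|r| <= cmod z -> cmod z < 1 -> I r.
  move=> rz z1; rewrite /I /= in_itv /= -ler_norml.
  exact: ltW (le_lt_trans rz z1).
have -> : x = X ((complex.Re x, complex.Im x), (complex.Re y, complex.Im y)) by case: (x).
have -> : y = Y ((complex.Re x, complex.Im x), (complex.Re y, complex.Im y)) by case: (y).
apply: qmax; rewrite inE; split; split=> /=.
- exact: inI (norm_Re_le_cmod x) x1.
- exact: inI (norm_Im_le_cmod x) x1.
- exact: inI (norm_Re_le_cmod y) y1.
- exact: inI (norm_Im_le_cmod y) y1.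
Qed.

End ProductTM.

Theorem theorem2p3 (R : realType) (n : nat) (f : R[i] * R[i] -> R[i])
    (a b : nat -> R[i]) :
  (1 <= n)%N ->
  H2 f ->
  (forall k : nat, (1 <= k < n)%N -> cmod (a k) < 1) ->
  (forall k : nat, (1 <= k < n)%N -> cmod (b k) < 1) ->
  let ext (u : nat -> R[i]) (x : R[i]) : nat -> R[i] := [eta u with n |-> x] in
  (forall x y : R[i], cmod x < 1 -> cmod y < 1 ->
     l2norm (Dn (ext a x) (ext b y) n f) ^+ 2 =
     \sum_(1 <= k < n.+1) \sum_(1 <= l < n.+1 | maxn k l == n)
       cmod (inner f (TM2 (ext a x) (ext b y) k l)) ^+ 2) /\
  (exists an bn : R[i],
     [/\ cmod an < 1, cmod bn < 1 &
       forall x y : R[i], cmod x < 1 -> cmod y < 1 ->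
         l2norm (Dn (ext a x) (ext b y) n f) ^+ 2 <=
         l2norm (Dn (ext a an) (ext b bn) n f) ^+ 2]).
Proof.
move=> n1 Hf an bn ext.
have in_disc (u : nat -> R[i]) (x : R[i]) : (forall k, (1 <= k < n)%N -> cmod (u k) < 1) -> cmod x < 1 ->
    forall j, (1 <= j <= n)%N -> cmod (ext u x j) < 1.
  move=> un x1 j /andP[j1]; rewrite leq_eqVlt => /predU1P[->|jn].
    by rewrite /ext /= eqxx.
  by rewrite /ext /= (ltn_eqF jn) un // j1.
have normE x y : cmod x < 1 -> cmod y < 1 ->
    l2norm (Dn (ext a x) (ext b y) n f) ^+ 2 = energy a b n f x y.
  by move=> x1 y1; rewrite sqr_l2norm_Dn //; exact: in_disc.
split; first exact: normE.
have [x [y [x1 y1 xymax]]] := energy_max an bn Hf.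
exists x, y; split; [exact: x1|exact: y1|move=> x' y' x1' y1'].
have := xymax _ _ x1' y1'.
by rewrite -(normE _ _ x1' y1') -(normE _ _ x1 y1).
Qed.
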